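(* Let $G$ be a locally elliptic group and $\omega$ a weight on $G$. Then $\omega$ satisfies the GRS condition, i.e. $\lim_{n\to\infty}\omega(x^n)^{1/n}=1$ for all $x\in G$.
   Context: A locally compact group $G$ is locally elliptic if every compact subset of $G$ generates a relatively compact subgroup. A weight on a locally compact group $G$ is a measurable function $\omega:G\to[1,\infty)$ that is bounded on compact sets, sub-multiplicative ($\omega(xy)\le\omega(x)\omega(y)$ for all $x,y$) and symmetric ($\omega(x)=\omega(x^{-1})$ for all $x$). *)

(* Defs.v *)
From HB Require Import structures.
From mathcomp Require Import all_boot all_order all_algebra.
From mathcomp Require Import all_classical all_reals all_analysis.

Set Implicit Arguments.
Unset Strict Implicit.
Unset Printing Implicit Defensive.

Import Order.TTheory GRing.Theory Num.Theory.
Import numFieldNormedType.Exports.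

Local Open Scope classical_set_scope.
Local Open Scope ring_scope.

HB.mixin Record isTopologicalGroup G & Topological G & Group G := {
  mulg_continuous : continuous (fun x : G * G => (x.1 * x.2)%g) ;
  invg_continuous : continuous (fun x : G => (x^-1)%g) ;
}.

(* The base point (pointedType) is arbitrary and unrelated to 1; it is only
   there because measurable types are required to be pointed. *)
#[short(type="topologicalGroupType")]
HB.structure Definition TopologicalGroup :=
  {G of PointedTopological G & Group G & isTopologicalGroup G}.

Section LocallyElliptic.
Variable G : topologicalGroupType.

(* Local compactness of groups includes the Hausdorff axiom. *)
Definition locally_compact_group : Prop :=
  hausdorff_space G /\ locally_compact [set: G].

Definition is_subgroup (H : set G) : Prop :=
  [/\ H 1%g,
      forall x y, H x -> H y -> H (x * y)%g &
      forall x, H x -> H (x^-1)%g].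

Definition generated_subgroup (A : set G) : set G := smallest is_subgroup A.

Definition locally_elliptic : Prop :=
  locally_compact_group /\
  forall K : set G, compact K -> precompact (generated_subgroup K).

End LocallyElliptic.

Section Weights.
Variables (R : realType) (G : topologicalGroupType).

(* G with its Borel sigma-algebra *)
Definition borel_group := g_sigma_algebraType (@open G).

Record is_weight (w : G -> R) : Prop := {
  weight_ge1 : forall x, 1 <= w x ;
  weight_measurable : measurable_fun [set: borel_group] (w : borel_group -> R) ;
  weight_bounded : forall K : set G, compact K -> [bounded w x | x in K] ;
  weight_submul : forall x y, w (x * y)%g <= w x * w y ;
  weight_sym : forall x, w (x^-1)%g = w x
}.

(* The value at n = 0 is irrelevant to the limit. *)
Definition GRS_condition (w : G -> R) : Prop :=
  forall x : G, w (x ^+ n)%g `^ (n%:R^-1) @[n --> \oo] --> (1 : R).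

End Weights.

Arguments locally_compact_group : clear implicits.
Arguments locally_elliptic : clear implicits.

(* Main.v *)
Require Import Defs.
From mathcomp Require Import all_boot all_order all_algebra.
From mathcomp Require Import all_classical all_reals all_analysis.

(** All powers of [x] lie in the subgroup generated by the compact set [{x}],
    which is relatively compact; hence [w (x ^+ n)] is bounded in [n] by some
    [M], and [1 <= w (x ^+ n) `^ (1/n) <= M `^ (1/n) --> 1]. *)

Import Order.TTheory GRing.Theory Num.Theory.
Import numFieldNormedType.Exports.
Local Open Scope classical_set_scope.
Local Open Scope ring_scope.

Lemma generated_subgroup_expg (G : topologicalGroupType) (A : set G) (x : G)
    (n : nat) : A x -> generated_subgroup A (x ^+ n)%g.
Proof.
move=> Ax H [[H1 HM _] AH]; elim: n => [|n IHn]; first by rewrite expg0.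
by rewrite expgS; apply: HM => //; exact: AH.
Qed.

Lemma weight_expg_bounded (R : realType) (G : topologicalGroupType)
    (w : G -> R) (x : G) :
  locally_elliptic G -> is_weight w ->
  exists M : R, forall n, w (x ^+ n)%g <= M.
Proof.
move=> [_ ellG] hw.
have [K genK [Kcompact _]] := ellG _ (@compact_set1 _ x).
have [M0 [_ wK]] := weight_bounded hw Kcompact.
(* Boundedness only says that each real strictly above [M0] bounds [|w|] on [K], hence the witness
   [M0 + 1]. *)
exists (M0 + 1) => n; apply: le_trans (ler_norm _) _.
apply: (wK (M0 + 1)); first by rewrite ltrDl.
by apply: genK; exact: generated_subgroup_expg.
Qed.

(** For positive [a] the power is [expR (n%:R^-1 * ln a)]; its argument tends to 0 and [expR] is
    continuous. *)
Lemma cvg_powR_invn (R : realType) (a : R) :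
  0 < a -> a `^ (n%:R^-1) @[n --> \oo] --> (1 : R).
Proof.
(* Dropping [n = 0] turns the exponents into the harmonic sequence. *)
move=> a0; rewrite -cvg_shiftS.
under eq_fun do rewrite /powR gt_eqF//.
have : expR (n.+1%:R^-1 * ln a) @[n --> \oo] --> expR (0 * ln a).
  apply: (@continuous_cvg _ _ _ _ _ _ expR); first exact: continuous_expR.
  by apply: cvgM; [exact: cvg_harmonic | exact: cvg_cst].
by rewrite mul0r expR0.
Qed.

Theorem proposition3p2 (R : realType) (G : topologicalGroupType)
    (hG : locally_elliptic G) (w : G -> R) (hw : is_weight w) :
  GRS_condition w.
Proof.
move=> x; have [M wM] := weight_expg_bounded _ _ _ x hG hw.
have w_ge1 n : 1 <= w (x ^+ n)%g by exact: weight_ge1.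
have M1 : 1 <= M := le_trans (w_ge1 0) (wM 0).
have M0 : 0 < M := lt_le_trans ltr01 M1.
apply: (squeeze_cvgr _ (cvg_cst (1 : R)) (cvg_powR_invn _ _ M0)).
(* The bounds hold for every [n]: at [n = 0] the exponent is [0^-1 = 0]. *)
apply: nearW => n; have n0 : (0 : R) <= n%:R^-1 by rewrite invr_ge0.
have w_ge0 : 0 <= w (x ^+ n)%g := le_trans ler01 (w_ge1 n).
(* With the lower bound 1 read as a power of 1, both inequalities are monotonicity of [powR] in its
   base. *)
rewrite -[X in X <= _ <= _](congr1 (@^~ (n%:R^-1 : R)) (@powR1 R)).
by rewrite !ge0_ler_powR ?nnegrE ?ler01// (le_trans w_ge0).
Qed.
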